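(* Let $n\ge 1$. For $M\in\mathbb{M}_n(\mathbb{C})$ define $\|M\|_{\mathrm{S}}=\max\{\|M\circ C\|: C\in\mathbb{M}_n(\mathbb{C}),\ \|C\|=1\}$. Let $\mathbb{P}_n(\mathbb{C})$ (resp. $\mathbb{P}_n(\mathbb{R})$) be the set of complex (resp. real) $n\times n$ matrices all of whose entries have modulus at most $1$, and set $c_n=\max\{\|M\|_{\mathrm{S}}: M\in\mathbb{P}_n(\mathbb{C})\}$ and $r_n=\max\{\|M\|_{\mathrm{S}}: M\in\mathbb{P}_n(\mathbb{R})\}$. Then: (1) $c_n=\sqrt{n}$. (2) $r_n\le\sqrt{n}$. (3) $r_n=\sqrt{n}$ if and only if there exists an $n\times n$ Hadamard matrix.
   Context: $\|\cdot\|$ is the operator norm (induced by the Euclidean norm), $\circ$ is the entrywise product. A Hadamard matrix is a square matrix with entries $\pm1$ whose columns are mutually orthogonal. *)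

(* Defs.v *)
From HB Require Import structures.
From mathcomp Require Import all_boot all_order all_algebra.
From mathcomp Require Import all_classical all_reals.
From mathcomp Require Import complex.

Set Implicit Arguments.
Unset Strict Implicit.
Unset Printing Implicit Defensive.

Import Order.TTheory GRing.Theory Num.Theory.
Import ComplexField.

Local Open Scope classical_set_scope.
Local Open Scope ring_scope.
Local Open Scope complex_scope.

Section Schur.
Variable R : realType.
Implicit Types (A : set R) (n : nat).

Definition maxima A : set R := A `&` ubound A.

Definition has_max A : Prop := maxima A !=set0.

(* The value is 0, without meaning, when [has_max A] fails. *)
Definition max_of A : R := xget 0 (maxima A).

Definition eucl_norm n (x : 'cV[R[i]]_n) : R :=
  Num.sqrt (\sum_i Normc.normc (x i 0) ^+ 2).

Definition op_norm n (C : 'M[R[i]]_n) : R :=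
  sup [set eucl_norm (C *m x) | x in [set x | eucl_norm x <= 1]].

Definition entrywise_mul n (M C : 'M[R[i]]_n) : 'M[R[i]]_n := map2_mx *%R M C.

Definition schur_values n (M : 'M[R[i]]_n) : set R :=
  [set op_norm (entrywise_mul M C) | C in [set C | op_norm C = 1]].

Definition schur_norm n (M : 'M[R[i]]_n) : R := max_of (schur_values M).

Definition polydisc_complex n : set 'M[R[i]]_n :=
  [set M : 'M[R[i]]_n | forall i j, Normc.normc (M i j) <= 1].

Definition polydisc_real n : set 'M[R]_n :=
  [set M : 'M[R]_n | forall i j, `|M i j| <= 1].

Definition schur_norms_complex n : set R :=
  [set schur_norm M | M in @polydisc_complex n].

(* The Schur norm of a real matrix is taken over complex matrices [C]. *)
Definition schur_norms_real n : set R :=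
  [set schur_norm (map_mx (real_complex R) M) | M in @polydisc_real n].

Definition c_ n : R := max_of (schur_norms_complex n).

Definition r_ n : R := max_of (schur_norms_real n).

Definition is_hadamard n (H : 'M[R]_n) : Prop :=
  (forall i j, H i j = 1 \/ H i j = -1) /\
  (forall j k, j != k -> \sum_i H i j * H i k = 0).

End Schur.

Arguments polydisc_complex : clear implicits.
Arguments polydisc_real : clear implicits.
Arguments schur_norms_complex : clear implicits.
Arguments schur_norms_real : clear implicits.
Arguments c_ : clear implicits.
Arguments r_ : clear implicits.

(* Main.v *)
From HB Require Import structures.
Require Import Defs.
From mathcomp Require Import all_boot all_order all_algebra.
From mathcomp Require Import all_classical all_reals complex.
From mathcomp Require Import cyclic cyclotomic separable.
From mathcomp Require Import topology normedtype derive.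
From mathcomp Require Import ring lra.

(* If [C] is a contraction, its columns have norm at most 1, so Cauchy-Schwarz
   on each row gives [|(M o C) x|^2 <= n * |x|^2] whenever the entries of [M]
   have modulus at most 1.  In case of equality with [|x| = 1], each vector
   [(C i j * x j)_j] is a multiple [l i] of the conjugate of row [i] of [M] and
   the columns of [C] are unit vectors.  A contraction with unit columns is
   unitary; its rows being unit vectors too, [|l i|] does not depend on [i], and
   the orthogonality of the columns of [C] becomes that of the columns of [M],
   whose entries have modulus 1.  Conversely, if [M] is such a complex Hadamard
   matrix, then [C = conj M / sqrt n] is unitary and [M o C] is the constant
   matrix [1 / sqrt n], of norm [sqrt n].  The Fourier matrix is an example for
   every [n].  The maxima exist because [(M, C, x)] may be taken in a compact
   set. *)

Set Implicit Arguments.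
Unset Strict Implicit.
Unset Printing Implicit Defensive.

Import Order.TTheory GRing.Theory Num.Theory.
Import ComplexField numFieldNormedType.Exports.

Local Open Scope ring_scope.
Local Open Scope complex_scope.

(* Locked, so that the morphism lemmas do not rewrite inside the square. *)
HB.lock Definition sqn (R : realType) (z : R[i]) : R := Normc.normc z ^+ 2.

(** * Squared moduli and Euclidean norms *)

Section Euclidean.
Local Open Scope classical_set_scope.
Variable R : realType.
Implicit Types (z w : R[i]) (n : nat).

Definition nsq n (x : 'cV[R[i]]_n) : R := \sum_i sqn (x i 0).

Lemma sqn_ReIm z : sqn z = complex.Re z ^+ 2 + complex.Im z ^+ 2.
Proof. by case: z => a b; rewrite sqn.unlock /= sqr_sqrtr // addr_ge0 ?sqr_ge0. Qed.

Lemma sqnE z : (sqn z)%:C = z * conjc z.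
Proof.
rewrite sqn_ReIm; case: z => a b /=; apply/eqP; rewrite eq_complex /=.
by apply/andP; split; apply/eqP; ring.
Qed.

Lemma sqnM z w : sqn (z * w) = sqn z * sqn w.
Proof. by rewrite sqn.unlock Normc.normcM exprMn. Qed.

Lemma sqnJ z : sqn (conjc z) = sqn z.
Proof. by apply: complexI; rewrite !sqnE conjcK mulrC. Qed.

Lemma sqn_ge0 z : 0 <= sqn z.
Proof. by rewrite sqn.unlock sqr_ge0. Qed.

Lemma sqn_eq0 z : (sqn z == 0) = (z == 0).
Proof.
rewrite sqn.unlock sqrf_eq0; apply/eqP/eqP => [|->]; [exact: Normc.eq0_normc|].
exact: Normc.normc0.
Qed.

Lemma sqn0 : sqn (0 : R[i]) = 0. Proof. by apply/eqP; rewrite sqn_eq0. Qed.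

Lemma sqn1 : sqn (1 : R[i]) = 1. Proof. by rewrite sqn.unlock Normc.normc1 expr1n. Qed.

Lemma sqn_real (a : R) : sqn a%:C = a ^+ 2.
Proof. by rewrite sqn_ReIm /= expr0n addr0. Qed.

Lemma normc_le1 z : (Normc.normc z <= 1) = (sqn z <= 1).
Proof.
rewrite sqn.unlock -[in RHS](expr1n R 2%N) ler_sqr ?nnegrE ?ler01 //.
by case: z => a b; apply: sqrtr_ge0.
Qed.

Lemma nsq_ge0 n (x : 'cV[R[i]]_n) : 0 <= nsq x.
Proof. by apply: sumr_ge0 => i _; apply: sqn_ge0. Qed.

Lemma nsqZ n z (x : 'cV[R[i]]_n) : nsq (z *: x) = sqn z * nsq x.
Proof. by rewrite mulr_sumr; apply: eq_bigr => i _; rewrite mxE sqnM. Qed.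

Lemma nsq0 n : nsq (0 : 'cV[R[i]]_n) = 0.
Proof. by apply: big1 => i _; rewrite mxE sqn0. Qed.

Lemma nsq_eq0 n (x : 'cV[R[i]]_n) : (nsq x == 0) = (x == 0).
Proof.
apply/eqP/eqP => [/psumr_eq0P x0|->]; last exact: nsq0.
apply/colP => i; rewrite mxE; apply/eqP; rewrite -sqn_eq0.
by rewrite x0 // => j _; apply: sqn_ge0.
Qed.

Lemma eucl_normE n (x : 'cV[R[i]]_n) : eucl_norm x = Num.sqrt (nsq x).
Proof.
by rewrite /eucl_norm /nsq; under [in RHS]eq_bigr do rewrite sqn.unlock.
Qed.

Lemma eucl_norm_le1 n (x : 'cV[R[i]]_n) : (eucl_norm x <= 1) = (nsq x <= 1).
Proof. by rewrite eucl_normE -[in LHS]sqrtr1 ler_sqrt. Qed.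

Lemma eucl_norm0 n : eucl_norm (0 : 'cV[R[i]]_n) = 0.
Proof. by rewrite eucl_normE nsq0 sqrtr0. Qed.

Lemma eucl_normZ n (a : R) (x : 'cV[R[i]]_n) :
  0 <= a -> eucl_norm (a%:C *: x) = a * eucl_norm x.
Proof.
move=> a0; rewrite !eucl_normE nsqZ sqn_real.
by rewrite sqrtrM ?sqr_ge0 // sqrtr_sqr ger0_norm.
Qed.

(* The defect in the Cauchy-Schwarz inequality [sqn s <= n * \sum_j sqn (b j)],
   valid when all [sqn (m j) <= 1]. *)
Lemma cauchy_schwarz_defect n (m b : 'I_n -> R[i]) (s := \sum_j m j * b j) :
  \sum_j sqn (n%:R * b j - conjc (m j) * s) + sqn s * (n%:R - \sum_j sqn (m j))
    + n%:R * sqn s = n%:R ^+ 2 * \sum_j sqn (b j).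
Proof.
apply: complexI; rewrite expr2 !(rmorphD, rmorphB, rmorphM, rmorph_sum) /=.
rewrite !rmorph_nat.
(* Summed over [j], the two cross terms give [- 2 * n * sqn s], and the last term cancels the part
   of the defect that contains [sqn (m j)]. *)
rewrite (eq_bigr (fun j => n%:R * n%:R * (sqn (b j))%:C
   - n%:R * conjc s * (m j * b j) - n%:R * s * conjc (m j * b j)
   + s * conjc s * (sqn (m j))%:C)); last first.
  move=> j _; rewrite !sqnE !(rmorphB, rmorphM) /= conjcK conjc_nat.
  by ring.
rewrite big_split /= !sumrB -!mulr_sumr -!rmorph_sum /= -/s sqnE.
by ring.
Qed.

Lemma sum_sqn_le n (m : 'I_n -> R[i]) :
  (forall j, sqn (m j) <= 1) -> \sum_j sqn (m j) <= n%:R.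
Proof.
by move=> m1; rewrite -[n in leRHS]card_ord -sumr_const; apply: ler_sum.
Qed.

Lemma sqn_sum_le n (b : 'I_n -> R[i]) :
  sqn (\sum_j b j) <= n%:R * \sum_j sqn (b j).
Proof.
have [n0|n0] := posnP n.
  by rewrite !big1 ?sqn0 ?mulr0 // => -[j jn]; exfalso; rewrite n0 in jn.
have n0' : 0 < n%:R :> R by rewrite ltr0n.
rewrite -(ler_pM2l n0') mulrA -expr2.
rewrite -(cauchy_schwarz_defect (fun=> 1) b) /=.
under [\sum_j 1 * b j]eq_bigr do rewrite mul1r.
rewrite lerDr addr_ge0 //; first by apply: sumr_ge0 => j _; apply: sqn_ge0.
rewrite mulr_ge0 ?sqn_ge0 // subr_ge0; apply: sum_sqn_le => j.
by rewrite sqn1.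
Qed.

(** A crude bound, which serves only to make the supremum in [op_norm] finite. *)
Lemma nsq_mulmx_le n (C : 'M[R[i]]_n) (x : 'cV[R[i]]_n) :
  nsq (C *m x) <= n%:R * (\sum_i \sum_j sqn (C i j)) * nsq x.
Proof.
rewrite -mulrA mulr_suml mulr_sumr; apply: ler_sum => i _.
rewrite mxE; apply: le_trans (sqn_sum_le _) _.
rewrite ler_wpM2l // mulr_suml; apply: ler_sum => j _.
rewrite sqnM ler_wpM2l ?sqn_ge0 // /nsq (bigD1 j) //= lerDl.
by apply: sumr_ge0 => k _; apply: sqn_ge0.
Qed.

(** * Operator norm and contractions *)

Lemma op_norm_has_sup n (C : 'M[R[i]]_n) :
  has_sup [set eucl_norm (C *m x) | x in [set x | eucl_norm x <= 1]].
Proof.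
split; first by exists (eucl_norm (C *m 0)), 0; rewrite //= eucl_norm0.
exists (Num.sqrt (n%:R * (\sum_i \sum_j sqn (C i j)))) => _ [x + <-].
rewrite /= eucl_norm_le1 eucl_normE => x1; apply: ler_wsqrtr.
apply: le_trans (nsq_mulmx_le _ _) _; apply: ler_piMr => //.
rewrite mulr_ge0 // sumr_ge0 // => i _; apply: sumr_ge0 => j _; exact: sqn_ge0.
Qed.

Lemma op_norm_ub n (C : 'M[R[i]]_n) x :
  eucl_norm x <= 1 -> eucl_norm (C *m x) <= op_norm C.
Proof.
by move=> x1; apply: sup_upper_bound; [exact: op_norm_has_sup | exists x].
Qed.

Lemma op_norm_le n (C : 'M[R[i]]_n) a :
  (forall x, eucl_norm x <= 1 -> eucl_norm (C *m x) <= a) -> op_norm C <= a.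
Proof.
move=> Ca; apply: ge_sup; first by case: (op_norm_has_sup C).
by move=> _ [x x1 <-]; apply: Ca.
Qed.

Lemma op_norm_ge0 n (C : 'M[R[i]]_n) : 0 <= op_norm C.
Proof.
by apply: le_trans (op_norm_ub C (x := 0) _); rewrite ?mulmx0 eucl_norm0.
Qed.

Definition contractive n (C : 'M[R[i]]_n) := forall x, nsq (C *m x) <= nsq x.

(** By homogeneity, a bound on the unit ball extends to all vectors. The squared form is free of
    square roots and of suprema. *)
Lemma op_norm_le1 n (C : 'M[R[i]]_n) : op_norm C <= 1 <-> contractive C.
Proof.
split=> [C1 x|cC]; last first.
  apply: op_norm_le => x; rewrite !eucl_norm_le1; exact: le_trans.
have [x0|x0] := eqVneq (nsq x) 0.
  by move/eqP: (x0); rewrite nsq_eq0 => /eqP ->; rewrite mulmx0.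
have xgt0 : 0 < nsq x by rewrite lt0r x0 nsq_ge0.
pose a := (Num.sqrt (nsq x))^-1.
have a2 : sqn a%:C = (nsq x)^-1 by rewrite sqn_real exprVn sqr_sqrtr ?nsq_ge0.
have : eucl_norm (C *m (a%:C *: x)) <= 1.
  apply: le_trans C1; apply: op_norm_ub.
  by rewrite eucl_norm_le1 nsqZ a2 mulVf.
by rewrite eucl_norm_le1 -scalemxAr nsqZ a2 mulrC ler_pdivrMr // mul1r.
Qed.

Lemma op_normZ_le n (C : 'M[R[i]]_n) (a : R) :
  0 <= a -> op_norm (a%:C *: C) <= a * op_norm C.
Proof.
move=> a0; apply: op_norm_le => x x1; rewrite -scalemxAl eucl_normZ //.
by rewrite ler_wpM2l // op_norm_ub.
Qed.

Lemma nsq_delta n (j : 'I_n) : nsq (delta_mx j 0 : 'cV[R[i]]_n) = 1.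
Proof.
rewrite /nsq (bigD1 j) //= big1 => [|i /negPf i0]; last by rewrite mxE i0 sqn0.
by rewrite addr0 mxE !eqxx sqn1.
Qed.

Lemma isometry_op_norm n (C : 'M[R[i]]_n) :
  (0 < n)%N -> (forall x, nsq (C *m x) = nsq x) -> op_norm C = 1.
Proof.
move=> n0 iC; apply/eqP; rewrite eq_le; apply/andP; split.
  by apply/op_norm_le1 => x; rewrite iC.
rewrite -[leLHS]sqrtr1 -(nsq_delta (Ordinal n0)) -iC -eucl_normE; apply: op_norm_ub.
by rewrite eucl_norm_le1 nsq_delta.
Qed.

Lemma op_norm_eq0 n (C : 'M[R[i]]_n) : op_norm C = 0 -> C = 0.
Proof.
move=> C0; apply/matrixP => i j.
have : nsq (C *m delta_mx j 0) == 0.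
  rewrite eq_le nsq_ge0 andbT -sqrtr_eq0 eq_le sqrtr_ge0 andbT -[leRHS]C0 -eucl_normE.
  by apply: op_norm_ub; rewrite eucl_norm_le1 nsq_delta.
by rewrite nsq_eq0 -colE => /eqP /colP /(_ i); rewrite !mxE.
Qed.

(** Leads from contractions, which suit the compactness argument, back to matrices of norm exactly
    1. For [C = 0] any [C'] of norm 1 will do, such as the identity. *)
Lemma op_norm1_rescale n (C : 'M[R[i]]_n) : (0 < n)%N ->
  exists2 C' : 'M[R[i]]_n, op_norm C' = 1 & C = (op_norm C)%:C *: C'.
Proof.
move=> n0; have [/[dup] C0 ->|C0] := eqVneq (op_norm C) 0.
  exists 1%:M; first by apply: isometry_op_norm => // x; rewrite mul1mx.
  by rewrite scale0r; apply: op_norm_eq0.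
have Cgt0 : 0 < op_norm C by rewrite lt0r C0 op_norm_ge0.
have CE : C = (op_norm C)%:C *: ((op_norm C)^-1%:C *: C).
  by rewrite scalerA -rmorphM divff // scale1r.
exists ((op_norm C)^-1%:C *: C) => //; apply/eqP; rewrite eq_le; apply/andP; split.
  apply: le_trans (op_normZ_le _ _) _; first by rewrite invr_ge0 ltW.
  by rewrite mulVf.
rewrite -(ler_pM2l Cgt0) mulr1 {1}CE; exact: op_normZ_le (ltW Cgt0).
Qed.

(** * Columns of contractions and the defect in the Schur bound *)

Lemma contractive_col n (C : 'M[R[i]]_n) j :
  contractive C -> \sum_i sqn (C i j) <= 1.
Proof.
move=> /(_ (delta_mx j 0)); rewrite nsq_delta -colE; apply: le_trans.
by apply: ler_sum => i _; rewrite mxE.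
Qed.

Lemma entrywise_mulmxE n (M C : 'M[R[i]]_n) (x : 'cV[R[i]]_n) i :
  (entrywise_mul M C *m x) i 0 = \sum_j M i j * (C i j * x j 0).
Proof. by rewrite mxE; apply: eq_bigr => j _; rewrite mxE mulrA. Qed.

(** The first two sums are the Cauchy-Schwarz defects of the rows; the third measures how far the
    columns of [C] are from unit vectors. All are nonnegative for contractive [C] and entries of [M]
    of modulus at most 1, so this one identity yields both the bound and its equality case. *)
Lemma schur_defect n (M C : 'M[R[i]]_n) (x : 'cV[R[i]]_n)
    (y := entrywise_mul M C *m x) :
  \sum_i \sum_j sqn (n%:R * (C i j * x j 0) - conjc (M i j) * y i 0)
  + \sum_i sqn (y i 0) * (n%:R - \sum_j sqn (M i j))
  + n%:R ^+ 2 * (\sum_j sqn (x j 0) * (1 - \sum_i sqn (C i j)))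
  + n%:R * nsq y = n%:R ^+ 2 * nsq x.
Proof.
have -> : \sum_j sqn (x j 0) * (1 - \sum_i sqn (C i j)) =
    nsq x - \sum_i \sum_j sqn (C i j * x j 0).
  rewrite exchange_big -sumrB; apply: eq_bigr => j _.
  rewrite mulrBr mulr1 mulr_sumr; congr (_ - _); apply: eq_bigr => i _.
  by rewrite sqnM mulrC.
(* The terms in [nsq x] cancel, and what remains is the Cauchy-Schwarz identity summed over the
   rows. *)
rewrite mulrBr -[X in _ + (_ - X) + _](_ :
  \sum_i \sum_j sqn (n%:R * (C i j * x j 0) - conjc (M i j) * y i 0)
  + \sum_i sqn (y i 0) * (n%:R - \sum_j sqn (M i j)) + n%:R * nsq y = _).
  by ring.
rewrite !mulr_sumr -!big_split /=; apply: eq_bigr => i _.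
have -> : y i 0 = \sum_j M i j * (C i j * x j 0) by exact: entrywise_mulmxE.
by rewrite cauchy_schwarz_defect.
Qed.

(* Expand [nsq (C *m (e_j + conjc g *: e_k)) <= 1 + sqn g], where [g] is the inner
   product of columns [j] and [k]: the cross term is [2 * sqn g]. *)
Lemma contractive_col_orthogonal n (C : 'M[R[i]]_n) j k : contractive C ->
  \sum_i sqn (C i j) = 1 -> \sum_i sqn (C i k) = 1 -> j != k ->
  \sum_i conjc (C i j) * C i k = 0.
Proof.
move=> cC Cj Ck jk.
(* [g] is kept opaque, so that it is handled as a single number below. *)
have [g gE] : exists g, \sum_i conjc (C i j) * C i k = g by eexists.
apply/eqP; rewrite gE -sqn_eq0.
rewrite eq_le sqn_ge0 andbT.
have := cC (delta_mx j 0 + conjc g *: delta_mx k 0).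
have -> : nsq (delta_mx j 0 + conjc g *: delta_mx k 0 : 'cV[R[i]]_n) = 1 + sqn g.
  rewrite /nsq (bigD1 j) // (bigD1 k) 1?eq_sym //= big1 => [|i /andP[ij ik]].
    rewrite !mxE !eqxx [k == j]eq_sym (negPf jk) !(mulr0, mulr1).
    by rewrite addr0 add0r sqn1 sqnJ addr0.
  by rewrite !mxE (negPf ij) (negPf ik) mulr0 addr0 sqn0.
have -> : nsq (C *m (delta_mx j 0 + conjc g *: delta_mx k 0)) =
    1 + sqn g + (sqn g + sqn g).
  rewrite mulmxDr -scalemxAr -!colE /nsq.
  apply: complexI; rewrite !(rmorphD, rmorph_sum) /= rmorph1.
  transitivity (\sum_i ((sqn (C i j))%:C + conjc g * g * (sqn (C i k))%:C
     + conjc g * (conjc (C i j) * C i k) + g * conjc (conjc (C i j) * C i k))).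
    apply: eq_bigr => i _; rewrite !mxE !sqnE !(rmorphD, rmorphM) /= !conjcK.
    by ring.
  rewrite !big_split /= -!mulr_sumr -!rmorph_sum /= gE Cj Ck sqnE.
  by ring.
by lra.
Qed.

Definition complex_hadamard n (M : 'M[R[i]]_n) :=
  (forall i j, sqn (M i j) = 1) /\
  (forall j k, j != k -> \sum_i conjc (M i j) * M i k = 0).

(** * The Schur bound and its equality case *)

Section Extremal.
Variables (n : nat) (M C : 'M[R[i]]_n) (x : 'cV[R[i]]_n).
Hypotheses (cC : contractive C) (M1 : forall i j, sqn (M i j) <= 1).
Let y := entrywise_mul M C *m x.

Let ge0_1 :
  0 <= \sum_i \sum_j sqn (n%:R * (C i j * x j 0) - conjc (M i j) * y i 0).
Proof. by do 2![apply: sumr_ge0 => ? _]; apply: sqn_ge0. Qed.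

Let ge0_2 i : 0 <= sqn (y i 0) * (n%:R - \sum_j sqn (M i j)).
Proof. by rewrite mulr_ge0 ?sqn_ge0 // subr_ge0 sum_sqn_le. Qed.

Let ge0_3 j : 0 <= sqn (x j 0) * (1 - \sum_i sqn (C i j)).
Proof. by rewrite mulr_ge0 ?sqn_ge0 // subr_ge0 contractive_col. Qed.

Lemma schur_bound : nsq (entrywise_mul M C *m x) <= n%:R * nsq x.
Proof.
have [n0|n0] := posnP n.
  by rewrite /nsq !big1 ?mulr0 // => -[j jn]; exfalso; rewrite n0 in jn.
rewrite -(ler_pM2l (_ : 0 < n%:R)) ?ltr0n // mulrA -expr2 -(schur_defect M C) lerDr.
apply: addr_ge0; first by apply: addr_ge0; [exact: ge0_1 | exact: sumr_ge0].
by rewrite mulr_ge0 ?exprn_ge0 // sumr_ge0.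
Qed.

Hypotheses (x1 : nsq x <= 1) (yn : n%:R <= nsq y) (n0 : (0 < n)%N).

(** When [nsq x <= 1] and [nsq y >= n], the identity leaves no room for any defect, so each summand
    of each defect vanishes. *)
Let defect0 :
  [/\ forall i j, n%:R * (C i j * x j 0) = conjc (M i j) * y i 0,
      forall i, y i 0 != 0 -> forall j, sqn (M i j) = 1,
      forall j, x j 0 != 0 -> \sum_i sqn (C i j) = 1 & nsq y = n%:R].
Proof.
have := ge0_1; set A := \sum_i _ => A0.
have : 0 <= \sum_i sqn (y i 0) * (n%:R - \sum_j sqn (M i j)) by exact: sumr_ge0.
set B := \sum_i _ * _ => B0.
have : 0 <= \sum_j sqn (x j 0) * (1 - \sum_i sqn (C i j)) by exact: sumr_ge0.
set D := \sum_j _ * _ => D0.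
have defE : A + B + n%:R ^+ 2 * D + n%:R * nsq y = n%:R ^+ 2 * nsq x.
  exact: schur_defect.
have n1 : 1 <= n%:R :> R by rewrite ler1n.
have [A_0 B_0 D_0 yE] : [/\ A = 0, B = 0, D = 0 & nsq y = n%:R].
  (* These bounds leave [A + B + n^2 * D <= 0]; comparing [D] with [n^2 * D] lets linear arithmetic
     conclude that [D = 0] too. *)
  have yn2 : n%:R ^+ 2 <= n%:R * nsq y by rewrite expr2 ler_wpM2l.
  have xn2 : n%:R ^+ 2 * nsq x <= n%:R ^+ 2 by rewrite ler_piMr ?exprn_ge0.
  have D_n : D <= n%:R ^+ 2 * D by rewrite ler_peMl // exprn_ege1.
  have yE : n%:R * nsq y = n%:R * n%:R by rewrite -expr2; lra.
  split; [lra..|]; apply: mulfI yE; rewrite pnatr_eq0 -lt0n //.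
split=> //.
- move=> i j; apply/eqP; rewrite -subr_eq0 -sqn_eq0; apply/eqP.
  have /psumr_eq0P -> // :
      \sum_j sqn (n%:R * (C i j * x j 0) - conjc (M i j) * y i 0) = 0.
    apply: (psumr_eq0P _ A_0) => // k _.
    by apply: sumr_ge0 => ? _; apply: sqn_ge0.
  by move=> k _; apply: sqn_ge0.
- move=> i; rewrite -sqn_eq0 => /mulfI yi j.
  have : \sum_j (1 - sqn (M i j)) = 0.
    rewrite sumrB sumr_const card_ord; apply: yi.
    by rewrite (psumr_eq0P _ B_0) ?mulr0.
  move=> /psumr_eq0P M1_0; apply/esym/eqP; rewrite -subr_eq0 M1_0 //.
  by move=> k _; rewrite subr_ge0.
- move=> j; rewrite -sqn_eq0 => /mulfI xj; apply/esym/eqP; rewrite -subr_eq0.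
  by apply/eqP/xj; rewrite (psumr_eq0P _ D_0) ?mulr0 // => k _.
Qed.

Lemma schur_extremal : complex_hadamard M.
Proof.
case: defect0 => bE My Cx yE.
have [i0 yi0] : exists i, y i 0 != 0.
  apply/existsP; apply: contra_eqT yE => /existsPn y0.
  have -> : y = 0 by apply/colP => i; rewrite [RHS]mxE; apply/eqP/negbNE/y0.
  by rewrite nsq0 eq_sym pnatr_eq0 -lt0n.
have nC0 : n%:R != 0 :> R[i] by rewrite pnatr_eq0 -lt0n.
have M0 i j : y i 0 != 0 -> M i j != 0.
  by move=> /My /(_ j) Mij; rewrite -sqn_eq0 Mij oner_eq0.
(* In row [i0] the products [C i0 j * x j] are proportional to nonzero numbers, so no coordinate of
   [x] vanishes and every column of [C] is a unit vector. *)
have xN0 j : x j 0 != 0.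
  have /eqP := bE i0 j; apply: contraTneq => ->; rewrite !mulr0 eq_sym mulf_eq0.
  by rewrite conjc_eq0 negb_or M0.
have colC j : \sum_i sqn (C i j) = 1 by apply: Cx.
have orthC j k : j != k -> \sum_i conjc (C i j) * C i k = 0.
  exact: contractive_col_orthogonal.
(* Orthonormal columns give a left inverse of the square matrix [C], which is also a right inverse;
   its diagonal gives the norms of the rows. *)
have rowC i : \sum_j sqn (C i j) = 1.
  have /mulmx1C/matrixP/(_ i i) : (map_mx conjc C)^T *m C = 1%:M.
    apply/matrixP => j k; rewrite !mxE.
    under eq_bigr do rewrite !mxE.
    have [->|jk] := eqVneq; last exact: orthC.
    under eq_bigr do rewrite mulrC -sqnE.
    by rewrite -rmorph_sum /= colC.
  rewrite !mxE eqxx => CC; apply: complexI; rewrite rmorph_sum /= -[RHS]CC.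
  by apply: eq_bigr => j _; rewrite !mxE sqnE.
(* If [y i] vanished, so would the whole row [i] of [C], which is a unit vector. *)
have yN0 i : y i 0 != 0.
  apply: contra_eq_neq (rowC i) => yi; rewrite big1 => [|j _].
    by rewrite eq_sym oner_neq0.
  apply/eqP; rewrite sqn_eq0; have /eqP := bE i j.
  by rewrite yi mulr0 !mulf_eq0 (negPf nC0) (negPf (xN0 j)) orbF.
split=> [i j|j k jk]; first exact: My.
(* Since [C i j = conjc (M i j) * y i / (n * x j)], row [i] having norm 1 reads [sqn (y i) * t = 1],
   where [t] is independent of [i]. *)
pose t := \sum_j (sqn (n%:R * x j 0))^-1.
have yt i : sqn (y i 0) = t^-1.
  have : sqn (y i 0) * t = 1.
    rewrite -(rowC i) mulr_sumr; apply: eq_bigr => l _.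
    have nx0 : sqn (n%:R * x l 0) != 0 by rewrite sqn_eq0 mulf_neq0.
    apply: (mulIf nx0); rewrite divfK // -sqnM mulrCA bE.
    by rewrite sqnM sqnJ My ?mul1r.
  move=> yt; rewrite -[t^-1]mul1r -yt mulfK //.
  by apply: contra_eq_neq yt => ->; rewrite mulr0 eq_sym oner_neq0.
have tN0 : (t^-1)%:C != 0.
  by rewrite -(yt i0) (inj_eq (@complexI _) _ 0) sqn_eq0.
apply: (mulIf tN0); rewrite mul0r mulr_suml.
(* The constant [t^-1 = y i * conjc (y i)] is distributed over the terms, turning entries of [M]
   into entries of [C]. *)
transitivity (n%:R ^+ 2 * (x j 0 * conjc (x k 0)) * \sum_i conjc (C i k) * C i j).
  rewrite mulr_sumr; apply: eq_bigr => i _.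
  rewrite -(yt i) sqnE.
  transitivity ((conjc (M i j) * y i 0) * conjc (conjc (M i k) * y i 0)).
    by rewrite rmorphM /= conjcK; ring.
  by rewrite -!bE !rmorphM /= conjc_nat; ring.
by rewrite orthC ?mulr0 // eq_sym.
Qed.
End Extremal.
End Euclidean.

(** * Complex Hadamard matrices attain the bound; the Fourier matrix *)

Section Attained.
Local Open Scope classical_set_scope.
Variable R : realType.
Implicit Types (z w : R[i]) (n : nat).

Lemma nsq_mulmx n (x : 'cV[R[i]]_n) :
  (nsq x)%:C = ((map_mx conjc x)^T *m x) 0 0.
Proof.
rewrite mxE rmorph_sum; apply: eq_bigr => i _.
by rewrite !mxE mulrC -sqnE.
Qed.

Lemma hadamard_attains n (M : 'M[R[i]]_n) : (0 < n)%N -> complex_hadamard M ->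
  exists2 C, op_norm C = 1 & Num.sqrt n%:R <= op_norm (entrywise_mul M C).
Proof.
move=> n0 [M1 Morth]; pose a : R := (Num.sqrt n%:R)^-1.
have nR0 : n%:R != 0 :> R by rewrite pnatr_eq0 -lt0n.
have sn0 : Num.sqrt n%:R != 0 :> R by rewrite sqrtr_eq0 -ltNge ltr0n.
have a2 : sqn a%:C = n%:R^-1 by rewrite sqn_real exprVn sqr_sqrtr.
exists (a%:C *: map_mx conjc M).
  apply: isometry_op_norm => // x; rewrite -scalemxAl nsqZ a2.
  (* The Gram matrix of the columns of the conjugate of [M] is [n] times the identity. *)
  suff -> : nsq (map_mx conjc M *m x) = n%:R * nsq x by rewrite mulKf.
  apply: complexI; rewrite rmorphM /= rmorph_nat !nsq_mulmx map_mxM trmx_mul.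
  rewrite -mulmxA [X in _ *m X]mulmxA (_ : _ *m map_mx conjc M = n%:R%:M).
    by rewrite mul_scalar_mx -scalemxAr [LHS]mxE.
  apply/matrixP => j k; rewrite !mxE.
  under eq_bigr do rewrite !mxE /= conjcK mulrC.
  have [->|jk] := eqVneq; last by apply: Morth; rewrite eq_sym.
  rewrite mulr1n; under eq_bigr do rewrite mulrC -sqnE M1.
  by rewrite sumr_const card_ord.
(* The test vector is the constant unit vector; the Schur product, all of whose entries are [a],
   sends it to the all-ones vector, of norm [sqrt n]. *)
have x1 : nsq (const_mx a%:C : 'cV[R[i]]_n) = 1.
  rewrite /nsq; under eq_bigr do rewrite mxE a2.
  by rewrite sumr_const card_ord -[_ *+ _]mulr_natr mulVf.
have := op_norm_ub (entrywise_mul M (a%:C *: map_mx conjc M)) (x := const_mx a%:C).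
rewrite eucl_norm_le1 x1 => /(_ (lexx _)); apply: le_trans.
rewrite eucl_normE ler_wsqrtr // /nsq (eq_bigr (fun=> 1)) => [|i _].
  by rewrite sumr_const card_ord.
rewrite entrywise_mulmxE (eq_bigr (fun=> a%:C * a%:C)) => [|j _].
  rewrite sumr_const card_ord -[_ *+ _]mulr_natl -(rmorph_nat (real_complex R)).
  rewrite -!rmorphM /=.
  by rewrite sqn_real -invfM -expr2 sqr_sqrtr // mulfV // expr1n.
rewrite !mxE; transitivity (M i j * conjc (M i j) * (a%:C * a%:C)); first by ring.
by rewrite -sqnE M1 mul1r.
Qed.

(** In characteristic 0, [X^n - 1] is separable; over an algebraically closed field it thus has [n]
    distinct roots, and one of them is primitive. *)
Lemma complex_prim_root_exists n : (0 < n)%N ->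
  exists z : R[i], n.-primitive_root z.
Proof.
move=> n_gt0; pose p : {poly R[i]} := 'X^n - 1.
have [r Dp] := closed_field_poly_normal p.
rewrite (monicP _) ?monicXnsubC // scale1r in Dp.
have rn1 : all n.-unity_root r by apply/allP=> z; rewrite -root_prod_XsubC -Dp.
have sz_r : (n < (size r).+1)%N.
  by rewrite -(size_prod_XsubC r id) -Dp size_XnsubC.
have [|z] := hasP (has_prim_root n_gt0 rn1 _ sz_r); last by exists z.
by rewrite -separable_prod_XsubC -Dp separable_Xn_sub_1 // pnatr_eq0 -lt0n.
Qed.

Lemma complex_hadamard_exists n : (0 < n)%N ->
  exists M : 'M[R[i]]_n, complex_hadamard M.
Proof.
move=> n0; have [z zP] := complex_prim_root_exists n0.
have zJ : z * conjc z = 1.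
  rewrite -sqnE; have -> : sqn z = 1; last by [].
  apply/eqP; rewrite -(@pexpr_eq1 _ _ n) ?sqn_ge0 //.
  have -> : sqn z ^+ n = sqn (z ^+ n).
    by elim: (n) => [|m IH]; rewrite ?sqn1 // !exprS sqnM IH.
  by rewrite prim_expr_order ?sqn1.
have z0 : z != 0 by apply: contra_eq_neq zJ => ->; rewrite mul0r eq_sym oner_neq0.
have conjz : conjc z = z^-1 by rewrite -[z^-1]mulr1 -zJ mulKf.
exists (\matrix_(i, j) z ^+ (i * j)); split=> [i j|j k jk].
  apply: complexI; rewrite mxE sqnE rmorphXn /= conjz exprVn mulfV //.
  by rewrite expf_neq0.
(* The inner product of columns [j] and [k] is the geometric sum of the powers of [w], an [n]-th
   root of unity other than 1. *)
pose w := z ^+ k / z ^+ j.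
have w1 : w - 1 != 0.
  rewrite subr_eq0; apply: contra_neq jk => /eqP.
  rewrite /w -(inj_eq (mulIf (expf_neq0 j z0))) divfK ?expf_neq0 // mul1r.
  rewrite (eq_prim_root_expr zP) !modn_small // => /eqP kj.
  exact/val_inj/esym.
apply: (mulfI w1); rewrite mulr0.
transitivity (w ^+ n - 1).
  rewrite subrX1; congr (_ * _); apply: eq_bigr => i _.
  by rewrite !mxE rmorphXn /= conjz exprVn /w expr_div_n -!exprM mulrC ![(i * _)%N]mulnC.
rewrite /w expr_div_n -!exprM ![(_ * n)%N]mulnC !exprM (prim_expr_order zP).
by rewrite !expr1n divr1 subrr.
Qed.

End Attained.

(** * Continuity of complex-valued functions *)

Section ComplexContinuity.
Local Open Scope classical_set_scope.
Variables (R : realType) (X : topologicalType).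
Implicit Types (f g : X -> R[i]).

(** Stated on real and imaginary parts, so that only the topology of [R] intervenes. *)
Definition ccontinuous f :=
  continuous (fun t => complex.Re (f t)) /\ continuous (fun t => complex.Im (f t)).

Lemma eq_ccontinuous f g : f =1 g -> ccontinuous f -> ccontinuous g.
Proof. by move=> /funext ->. Qed.

Lemma ccontinuous_cst z : ccontinuous (fun=> z).
Proof. by split=> t; apply: cvg_cst. Qed.

Lemma ccontinuous_real (h : X -> R) : continuous h -> ccontinuous (fun t => (h t)%:C).
Proof. by move=> ch; split=> // t; apply: cvg_cst. Qed.

Lemma ccontinuousD f g :
  ccontinuous f -> ccontinuous g -> ccontinuous (fun t => f t + g t).
Proof.
move=> [fR fI] [gR gI]; split.
  under [X in continuous X]eq_fun do rewrite raddfD.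
  by move=> t; apply: cvgD; [exact: fR | exact: gR].
under [X in continuous X]eq_fun do rewrite raddfD.
by move=> t; apply: cvgD; [exact: fI | exact: gI].
Qed.

Lemma ccontinuousM f g :
  ccontinuous f -> ccontinuous g -> ccontinuous (fun t => f t * g t).
Proof.
move=> [fR fI] [gR gI]; split.
  rewrite (_ : (fun t => _) = fun t => complex.Re (f t) * complex.Re (g t)
      - complex.Im (f t) * complex.Im (g t)).
    move=> t; apply: cvgB; apply: cvgM;
      [exact: fR | exact: gR | exact: fI | exact: gI].
  by apply: funext => t; case: (f t) (g t) => [? ?] [? ?].
rewrite (_ : (fun t => _) = fun t => complex.Re (f t) * complex.Im (g t)
      + complex.Im (f t) * complex.Re (g t)).
  move=> t; apply: cvgD; apply: cvgM;
    [exact: fR | exact: gI | exact: fI | exact: gR].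
by apply: funext => t; case: (f t) (g t) => [? ?] [? ?].
Qed.

Lemma ccontinuous_sum I (r : seq I) (F : I -> X -> R[i]) :
  (forall i, ccontinuous (F i)) -> ccontinuous (fun t => \sum_(i <- r) F i t).
Proof.
move=> cF; elim: r => [|i r IH].
  by under eq_fun do rewrite big_nil; exact: ccontinuous_cst.
by under eq_fun do rewrite big_cons; exact: ccontinuousD.
Qed.

Lemma continuous_sqn f : ccontinuous f -> continuous (fun t => sqn (f t)).
Proof.
move=> [fR fI]; under [X in continuous X]eq_fun do rewrite sqn_ReIm.
move=> t; apply: cvgD; [|].
  by apply: cvgM; exact: fR.
by apply: cvgM; exact: fI.
Qed.

Lemma continuous_nsq n (v : X -> 'cV[R[i]]_n) :
  (forall i, ccontinuous (fun t => v t i 0)) -> continuous (fun t => nsq (v t)).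
Proof.
by move=> cv; apply: continuous_big => [|i _];
  [exact: add_continuous | exact: continuous_sqn].
Qed.

Lemma closed_le_continuous (h k : X -> R) :
  continuous h -> continuous k -> closed [set t | h t <= k t].
Proof.
move=> ch ck; have /continuous_closedP : continuous (fun t => h t - k t).
  by move=> t; apply: cvgB; [exact: ch | exact: ck].
move=> /(_ _ (@closed_le R 0)); congr closed.
by apply/seteqP; split=> t /=; rewrite subr_le0.
Qed.

End ComplexContinuity.

(** * Existence of maxima by compactness *)

Section SchurMaximum.
Local Open Scope classical_set_scope.
Variables (R : realType) (n : nat).

Lemma sqn_le1_ReIm (z : R[i]) : sqn z <= 1 ->
  -1 <= complex.Re z <= 1 /\ -1 <= complex.Im z <= 1.
Proof. by rewrite sqn_ReIm => ?; split; apply/andP; split; nra. Qed.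

(* Real coordinates of a triple [(T, C, x)]; the boolean selects the real part. *)
Let coord := ('I_n * 'I_n + (bool * ('I_n * 'I_n) + bool * 'I_n))%type.
Let X := {ptws coord -> R}.
Let Tz (t : X) : 'M[R]_n := \matrix_(i, j) t (inl (i, j)).
Let Cz (t : X) : 'M[R[i]]_n :=
  \matrix_(i, j) (t (inr (inl (true, (i, j)))) +i* t (inr (inl (false, (i, j)))))%C.
Let xz (t : X) : 'cV[R[i]]_n :=
  \col_i (t (inr (inr (true, i))) +i* t (inr (inr (false, i))))%C.

Let coord_continuous (c : coord) : continuous (fun t : X => t c).
Proof. exact: (@proj_continuous _ (fun=> R : topologicalType) c). Qed.

(* [K = {1}] gives the maximum defining the Schur norm of [B]; for the constant
   matrix [B = 1], [K = [-1, 1]] gives the maximum over all real matrices. *)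
Lemma schur_compact_max (B : 'M[R[i]]_n) (K : set R) : compact K -> K !=set0 ->
  let val T C x :=
    nsq (entrywise_mul (entrywise_mul B (map_mx (real_complex R) T)) C *m x) in
  exists (T : 'M[R]_n) (C : 'M[R[i]]_n) (x : 'cV[R[i]]_n),
  [/\ forall i j, K (T i j), contractive C, nsq x <= 1 &
    forall (T' : 'M[R]_n) C' x',
    (forall i j, K (T' i j)) -> contractive C' -> nsq x' <= 1 ->
    val T' C' x' <= val T C x].
Proof.
move=> cK [k Kk] val.
(* A product of compact sets, compact by Tychonoff; [S] is cut out of it by closed conditions. *)
pose box (c : coord) : set R := if c is inl _ then K else `[-1, 1].
pose S := [set t : X | forall c, box c (t c)] `&`
  ([set t | contractive (Cz t)] `&` [set t | nsq (xz t) <= 1]).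
have cT i j : ccontinuous (fun t => (Tz t i j)%:C).
  apply: (@eq_ccontinuous R X (fun t : X => (t (inl (i, j)))%:C)) => [t|].
    by rewrite mxE.
  exact/ccontinuous_real/coord_continuous.
have cC i j : ccontinuous (fun t => Cz t i j).
  split; last first.
    rewrite (_ : (fun t => _) = fun t : X => t (inr (inl (false, (i, j))))).
      exact: coord_continuous.
    by apply/funext => t; rewrite mxE.
  rewrite (_ : (fun t => _) = fun t : X => t (inr (inl (true, (i, j))))).
    exact: coord_continuous.
  by apply/funext => t; rewrite mxE.
have cx i : ccontinuous (fun t => xz t i 0).
  split; last first.
    rewrite (_ : (fun t => _) = fun t : X => t (inr (inr (false, i)))).
      exact: coord_continuous.
    by apply/funext => t; rewrite mxE.
  rewrite (_ : (fun t => _) = fun t : X => t (inr (inr (true, i)))).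
    exact: coord_continuous.
  by apply/funext => t; rewrite mxE.
have compS : compact S.
  apply: compact_closedI.
    apply: (@tychonoff _ (fun=> R : topologicalType)) => -[c|c] //.
    exact: segment_compact.
  apply: closedI; last first.
    apply: (@closed_le_continuous R X (fun t => nsq (xz t)) (fun=> 1)).
      exact: continuous_nsq.
    exact: cst_continuous.
  (* Testing one vector [y] at a time makes contractivity an intersection of closed conditions. *)
  rewrite (_ : mkset _ = \bigcap_(y in setT) [set t | nsq (Cz t *m y) <= nsq y]).
    apply: closed_bigI => y _.
    apply: (@closed_le_continuous R X (fun t => nsq (Cz t *m y)) (fun=> nsq y));
      last exact: cst_continuous.
    apply: continuous_nsq => i.
    apply: (@eq_ccontinuous R X (fun t : X => \sum_j Cz t i j * y j 0)) => [t|].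
      by rewrite mxE.
    apply: ccontinuous_sum => j; apply: ccontinuousM => //; exact: ccontinuous_cst.
  by apply/seteqP; split=> [t tC y _|t tC y]; [exact: tC | exact: (tC y I)].
have S0 : S !=set0.
  exists (fun c => if c is inl _ then k else 0); split.
    by case=> [c|c] //=; rewrite in_itv /= lerN10 ler01.
  have C0 : Cz (fun c => if c is inl _ then k else 0) = 0.
    by apply/matrixP => i j; rewrite !mxE.
  have x0 : xz (fun c => if c is inl _ then k else 0) = 0.
    by apply/matrixP => i j; rewrite !mxE.
  by split=> [y|] /=; rewrite ?C0 ?x0 ?mul0mx nsq0 ?nsq_ge0.
have cval : continuous (fun t => val (Tz t) (Cz t) (xz t)).
  apply: continuous_nsq => i.
  apply: (@eq_ccontinuous R X
    (fun t : X => \sum_j (B i j * (Tz t i j)%:C) * (Cz t i j * xz t j 0))) => [t|].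
    rewrite entrywise_mulmxE; apply: eq_bigr => j _.
    by rewrite [entrywise_mul _ _ _ _]mxE [map_mx _ _ _ _]mxE.
  apply: ccontinuous_sum => j; apply: ccontinuousM; last exact: ccontinuousM.
  apply: ccontinuousM => //; exact: ccontinuous_cst.
have [t] := compact_EVT_max S0 compS (continuous_subspaceT cval).
rewrite inE => -[tbox [tC tx]] tmax.
exists (Tz t), (Cz t), (xz t); split=> // [i j|T' C' x' T'K C'1 x'1].
  by rewrite mxE; exact: (tbox (inl (i, j))).
pose t' : X := fun c => match c with
  | inl (i, j) => T' i j
  | inr (inl (b, (i, j))) => if b then complex.Re (C' i j) else complex.Im (C' i j)
  | inr (inr (b, i)) => if b then complex.Re (x' i 0) else complex.Im (x' i 0)
  end.
have T'E : Tz t' = T' by apply/matrixP => i j; rewrite mxE.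
have C'E : Cz t' = C' by apply/matrixP => i j; rewrite mxE /=; case: (C' i j).
have x'E : xz t' = x' by apply/colP => i; rewrite mxE /=; case: (x' i 0).
rewrite -T'E -C'E -x'E; apply: tmax; rewrite inE; split; last first.
  by split=> /=; rewrite ?C'E ?x'E.
(* The box excludes no competitor: entries of a contraction, and of a vector of norm at most 1, have
   modulus at most 1. *)
case=> [[i j]|[[b [i j]]|[b i]]] /=; first exact: T'K.
  have /sqn_le1_ReIm [? ?] : sqn (C' i j) <= 1.
    apply: le_trans (contractive_col j C'1); rewrite (bigD1 i) //= lerDl.
    by apply: sumr_ge0 => ? _; apply: sqn_ge0.
  by case: b; rewrite in_itv.
have /sqn_le1_ReIm [? ?] : sqn (x' i 0) <= 1.
  apply: le_trans x'1; rewrite /nsq (bigD1 i) //= lerDl.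
  by apply: sumr_ge0 => ? _; apply: sqn_ge0.
by case: b; rewrite in_itv.
Qed.

(** The maximizing contraction is [op_norm C] times a matrix of norm 1; as [op_norm C <= 1], that
    matrix does at least as well. *)
Lemma schur_max (B : 'M[R[i]]_n) (K : set R) : (0 < n)%N -> compact K -> K !=set0 ->
  let mx T := entrywise_mul B (map_mx (real_complex R) T) in
  exists (T : 'M[R]_n) (C : 'M[R[i]]_n) (x : 'cV[R[i]]_n),
  [/\ forall i j, K (T i j), op_norm C = 1, eucl_norm x <= 1 &
    forall (T' : 'M[R]_n) C', (forall i j, K (T' i j)) -> op_norm C' = 1 ->
    op_norm (entrywise_mul (mx T') C') <= eucl_norm (entrywise_mul (mx T) C *m x)].
Proof.
move=> n0 cK K0 mx; have [T [C [x [TK C1 x1 Tmax]]]] := schur_compact_max B cK K0.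
have [C' C'1 CE] := op_norm1_rescale C n0.
exists T, C', x; split=> // [|T' C'' T'K C''1]; first by rewrite eucl_norm_le1.
apply: op_norm_le => y; rewrite eucl_norm_le1 => y1; rewrite !eucl_normE.
apply: ler_wsqrtr; apply: le_trans (Tmax _ _ _ T'K _ y1) _.
  by apply/op_norm_le1; rewrite C''1.
rewrite [in leLHS]CE (_ : entrywise_mul _ (_ *: _) =
    (op_norm C)%:C *: entrywise_mul (mx T) C').
  rewrite -scalemxAl nsqZ sqn_real ler_piMl ?nsq_ge0 // exprn_ile1 ?op_norm_ge0 //.
  exact/op_norm_le1.
by apply/matrixP => i j; rewrite !mxE mulrCA.
Qed.
End SchurMaximum.

(** * Schur norms and the extremal constants *)

Section SchurNorm.
Local Open Scope classical_set_scope.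
Variables (R : realType) (n : nat).
Hypothesis n0 : (0 < n)%N.
Implicit Types M C : 'M[R[i]]_n.

Lemma max_ofP (A : set R) : has_max A -> maxima A (max_of A).
Proof. by move=> [a Aa]; apply: xgetPex; exists a. Qed.

Lemma has_max_schur_values M : has_max (schur_values M).
Proof.
have [T [C [x [T1 C1 x1 Cmax]]]] :=
  schur_max M n0 (@compact_set1 R 1) (ex_intro _ 1 erefl).
have ME (T' : 'M[R]_n) : (forall i j, T' i j = 1) ->
    entrywise_mul M (map_mx (real_complex R) T') = M.
  by move=> T'1; apply/matrixP => i j; rewrite !mxE T'1 mulr1.
exists (op_norm (entrywise_mul M C)); split; first by exists C.
move=> _ [C' C'1 <-]; apply: le_trans (op_norm_ub _ x1).
by have := Cmax T C' T1 C'1; rewrite ME.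
Qed.

Lemma schur_norm_ge M C :
  op_norm C = 1 -> op_norm (entrywise_mul M C) <= schur_norm M.
Proof.
by move=> C1; apply: (max_ofP (has_max_schur_values M)).2; exists C.
Qed.

Lemma schur_norm_attained M :
  exists2 C, op_norm C = 1 & op_norm (entrywise_mul M C) = schur_norm M.
Proof. by have [[C ? ?] _] := max_ofP (has_max_schur_values M); exists C. Qed.

Lemma schur_norm_le M :
  polydisc_complex R n M -> schur_norm M <= Num.sqrt n%:R.
Proof.
move=> M1; have [C C1 <-] := schur_norm_attained M.
apply: op_norm_le => x; rewrite eucl_norm_le1 eucl_normE => x1.
apply: ler_wsqrtr; apply: le_trans (schur_bound _ _ _) _.
- by apply/op_norm_le1; rewrite C1.
- by move=> i j; rewrite -normc_le1.
- by rewrite ler_piMr.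
Qed.

Lemma real_polydisc_complex (M : 'M[R]_n) :
  polydisc_real R n M -> polydisc_complex R n (map_mx (real_complex R) M).
Proof.
move=> M1 i j; rewrite mxE normc_le1 sqn_real -real_normK ?num_real //.
by rewrite exprn_ile1.
Qed.

(** [C] and [x] are kept along with [T] because the equality case needs an actual vector, not just a
    supremum. *)
Lemma real_schur_max : exists (T : 'M[R]_n) C x,
  [/\ polydisc_real R n T, op_norm C = 1, eucl_norm x <= 1 &
    forall T', polydisc_real R n T' -> schur_norm (map_mx (real_complex R) T') <=
      eucl_norm (entrywise_mul (map_mx (real_complex R) T) C *m x)].
Proof.
have K0 : `[-1 : R, 1] !=set0.
  by exists 0; rewrite /= in_itv /= lerN10 ler01.
have [T [C [x [TK C1 x1 Tmax]]]] :=
  schur_max (const_mx 1) n0 (@segment_compact R (-1) 1) K0.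
have TE (T' : 'M[R]_n) : entrywise_mul (const_mx 1) (map_mx (real_complex R) T') =
    map_mx (real_complex R) T'.
  by apply/matrixP => i j; rewrite !mxE mul1r.
exists T, C, x; split=> // [i j|T' T'1].
  by rewrite ler_norml; have := TK i j; rewrite /= in_itv.
have [C' C'1 <-] := schur_norm_attained (map_mx (real_complex R) T').
rewrite -[map_mx _ T]TE -[map_mx _ T']TE; apply: Tmax => // i j.
by rewrite /= in_itv /= -ler_norml; apply: T'1.
Qed.

Lemma has_max_schur_norms_real : has_max (schur_norms_real R n).
Proof.
have [T [C [x [T1 C1 x1 Tmax]]]] := real_schur_max.
exists (schur_norm (map_mx (real_complex R) T)); split; first by exists T.
move=> _ [T' T'1 <-]; apply: le_trans (Tmax _ T'1) _.
exact: le_trans (op_norm_ub _ x1) (schur_norm_ge _ C1).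
Qed.

Lemma maxima_schur_norms_complex :
  maxima (schur_norms_complex R n) (Num.sqrt n%:R).
Proof.
have [M Mhad] := complex_hadamard_exists R n0.
have Mdisc : polydisc_complex R n M by move=> i j; rewrite normc_le1 Mhad.1.
split; last by move=> _ [M' M'1 <-]; apply: schur_norm_le.
exists M => //; apply/eqP; rewrite eq_le schur_norm_le //=.
have [C C1 /le_trans] := hadamard_attains n0 Mhad; apply.
exact: schur_norm_ge.
Qed.

(** A real number of modulus 1 is a sign, and conjugation fixes real entries. *)
Lemma hadamardP (H : 'M[R]_n) :
  is_hadamard H <-> complex_hadamard (map_mx (real_complex R) H).
Proof.
have sumE j k : \sum_i conjc (map_mx (real_complex R) H i j) *
    map_mx (real_complex R) H i k = (\sum_i H i j * H i k)%:C.
  rewrite rmorph_sum; apply: eq_bigr => i _.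
  by rewrite !mxE conjc_real -rmorphM.
split=> [[H1 Horth]|[H1 Horth]]; split.
- by move=> i j; rewrite mxE sqn_real; case: (H1 i j) => ->; rewrite ?sqrrN expr1n.
- by move=> j k jk; rewrite sumE Horth.
- move=> i j; have /eqP := H1 i j; rewrite mxE sqn_real sqrf_eq1.
  by case/orP => /eqP ->; [left | right].
- by move=> j k jk; apply: complexI; rewrite -sumE Horth.
Qed.

Lemma r_le : r_ R n <= Num.sqrt n%:R.
Proof.
rewrite /r_; have [[M M1 <-] _] := max_ofP has_max_schur_norms_real.
by apply: schur_norm_le; apply: real_polydisc_complex.
Qed.

Lemma r_eq_hadamard :
  r_ R n = Num.sqrt n%:R <-> exists H : 'M[R]_n, is_hadamard H.
Proof.
have [rM rub] := max_ofP has_max_schur_norms_real; rewrite -/(r_ R n) in rM rub.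
split=> [rn|[H /[dup] [[H1 _]] /hadamardP cH]].
  (* The value at this triple is at least [r_ R n], hence at least [sqrt n]: this is the equality
     case for [T]. *)
  have [T [C [x [T1 C1 x1 Tmax]]]] := real_schur_max.
  exists T; apply/hadamardP; apply: (schur_extremal (C := C) (x := x)) => //.
  - by apply/op_norm_le1; rewrite C1.
  - by move=> i j; rewrite -normc_le1; apply: real_polydisc_complex.
  - by rewrite -eucl_norm_le1.
  - rewrite -(@ler_sqrt _ _ (nsq _)) ?nsq_ge0 // -eucl_normE -rn.
    by case: rM => M M1 <-; apply: Tmax.
have [C C1 nC] := hadamard_attains n0 cH.
apply/eqP; rewrite eq_le r_le; apply: le_trans nC _.
apply: le_trans (schur_norm_ge _ C1) _; apply: rub; exists H => // i j.
by case: (H1 i j) => ->; rewrite ?normrN normr1.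
Qed.

End SchurNorm.

Theorem theorem3 (R : realType) (n : nat) (hn : (1 <= n)%N) :
  [/\ (forall M : 'M[complex R]_n, has_max (schur_values M)),
      has_max (schur_norms_complex R n)
    & has_max (schur_norms_real R n)] /\
  [/\ c_ R n = Num.sqrt n%:R,
      r_ R n <= Num.sqrt n%:R
    & r_ R n = Num.sqrt n%:R <-> exists H : 'M[R]_n, is_hadamard H].
Proof.
have cmax := maxima_schur_norms_complex R hn.
have hasc : has_max (schur_norms_complex R n) by exists (Num.sqrt n%:R).
split; split=> //.
- exact: has_max_schur_values.
- exact: has_max_schur_norms_real.
- have [cM cub] := max_ofP hasc; rewrite /c_; apply/eqP; rewrite eq_le.
  by rewrite cmax.2 //= cub //; case: cmax.
- exact: r_le.
- exact: r_eq_hadamard.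
Qed.
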